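(* (Gluing Formula.) Let $S$ be a complete semiring, $(\mathbf{C},\otimes,I)$ a small strict monoidal category, $\mathcal{F}$ a system of fields and $\mathbb{T}$ a system of $\mathbf{C}$-valued action exponentials. Let $W'$ be a bordism from $M$ to $N$ and let $W''$ be a bordism from $N$ to $P$. Let $W=W'\cup_N W''$ be the bordism from $M$ to $P$ obtained by gluing $W'$ and $W''$ along $N$. Then the state sum of $W$ can be calculated as the contraction inner product $$Z_W=\langle Z_{W'},Z_{W''}\rangle\in Z(M)\,\widehat{\otimes}\,Z(P)\cong Z(M\sqcup P).$$
   Context: A semiring $(S,+,\cdot,0,1)$ consists of a commutative monoid $(S,+,0)$ and a (not necessarily commutative) monoid $(S,\cdot,1)$ such that $\cdot$ distributes over $+$ from both sides and $0$ is absorbing. A complete monoid is a commutative monoid $(M,+,0)$ with a summation law assigning to every family $(m_i)_{i\in I}$, $I$ an arbitrary set, an element $\sum_{i\in I}m_i$ such that $\sum_{i\in\varnothing}m_i=0$, $\sum_{i\in\{1\}}m_i=m_1$, $\sum_{i\in\{1,2\}}m_i=m_1+m_2$, and $\sum_{j\in J}\big(\sum_{i\in I_j}m_i\big)=\sum_{i\in I}m_i$ for every partition $I=\bigcup_{j\in J}I_j$. A semiring is complete if $(S,+,0,\sum)$ is a complete monoid and $\sum_i ss_i=s\sum_i s_i$, $\sum_i s_is=(\sum_i s_i)s$. $Q=Q_S(\mathbf{C})$ is the complete monoid of functions $\operatorname{Mor}(\mathbf{C})\to S$ with pointwise addition and summation. The composition semiring is $Q^c=(Q,+,\cdot,0,1)$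 with $(a\cdot b)(\gamma)=\sum_{\beta\circ\alpha=\gamma}b(\beta)a(\alpha)$ (sum over all composable pairs with $\beta\circ\alpha=\gamma$) and $1$ the characteristic function of the set of identity morphisms; it is a complete semiring. Fix an integer $n\ge 0$. Manifolds are topological and need not be orientable; $\varnothing$ is a manifold of every dimension; $\sqcup$ is the ordered disjoint union. A bordism from $M$ to $N$ is a triple $(W,M,N)$ (often abbreviated $W$) with $W$ a compact $(n+1)$-dimensional topological manifold, $\partial W=M\sqcup N$, where the closed $n$-manifolds $M,N$ are the incoming and outgoing boundary. $(W,M,N)\sqcup(W',M',N')=(W\sqcup W',M\sqcup M',N\sqcup N')$. If $W'$ is a bordism from $M$ to $N$ and $W''$ a bordism from $N$ to $P$, gluing along $N$ yields the bordism $W'\cup_N W''$ from $M$ to $P$. A homeomorphism of bordisms is a homeomorphism preserving incoming and outgoing boundaries. $(W_0,M_0,N_0)$ is a subbordism of $(W,M,N)$ if $W_0\subset W$ is a codimension $0$ submanifold, every connected component $C$ of $M_0$ satisfies $C\cap\partial W=\varnothing$ or $C\subset M$, and every connected component $C$ of $N_0$ satisfies $C\cap\partial W=\varnothing$ or $C\subset N$. A system $\mathcal{F}$ of fields assigns to each bordism $W$ a set $\mathcal{F}(W)$ and to each closed $n$-manifold $M$ a set $\mathcal{F}(M)$, with $\mathcal{F}(\varnothing)$ a one-element set, such that: (FRES) There are restriction maps $\mathcal{F}(W)\to\mathcal{F}(W_0)$ for subbordisms $W_0\subset W$, $\mathcal{F}(M)\to\mathcal{F}(M_0)$ for codimension $0$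 submanifolds $M_0\subset M$, and $\mathcal{F}(W)\to\mathcal{F}(M)$ for closed codimension $1$ submanifolds $M\subset W$; they are written $f\mapsto f|_{(-)}$ and commute with each other in the obvious way (restricting in stages equals restricting directly). (FHOMEO) A homeomorphism of bordisms $\phi:W\to W'$ induces a bijection $\phi^*:\mathcal{F}(W')\to\mathcal{F}(W)$ with $(\operatorname{id}_W)^*=\operatorname{id}$, $(\psi\circ\phi)^*=\phi^*\circ\psi^*$; similarly for homeomorphisms of closed $n$-manifolds; these maps commute with the restriction maps. (FDISJ) The products of restrictions $\mathcal{F}(W\sqcup W')\to\mathcal{F}(W)\times\mathcal{F}(W')$ and $\mathcal{F}(M\sqcup N)\to\mathcal{F}(M)\times\mathcal{F}(N)$ are bijections. (FGLUE) For $W=W'\cup_N W''$, the map $\mathcal{F}(W)\to\mathcal{F}(W')\times_{\mathcal{F}(N)}\mathcal{F}(W'')$ given by the restrictions to $W'$ and $W''$ is a bijection onto the pullback. A system $\mathbb{T}$ of $\mathbf{C}$-valued action exponentials consists of functions $\mathbb{T}_W:\mathcal{F}(W)\to\operatorname{Mor}(\mathbf{C})$ for all bordisms $W$ with $\mathbb{T}_\varnothing(p)=\operatorname{id}_I$ ($p$ the unique element of $\mathcal{F}(\varnothing)$) such that: (TDISJ) $\mathbb{T}_{W\sqcup W'}(f)=\mathbb{T}_W(f|_W)\otimes\mathbb{T}_{W'}(f|_{W'})$; (TGLUE) for $W=W'\cup_NW''$, $\mathbb{T}_W(f)=\mathbb{T}_{W''}(f|_{W''})\circ\mathbb{T}_{W'}(f|_{W'})$;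 (THOMEO) for a homeomorphism of bordisms $\phi:W\to W'$ and $f\in\mathcal{F}(W')$, $\mathbb{T}_W(\phi^*f)=\mathbb{T}_{W'}(f)$. For a closed $n$-manifold $M$, the state module $Z(M)$ is the set of functions $z:\mathcal{F}(M)\to Q$ with $z(\phi^*f)=z(f)$ for all $f$ and all homeomorphisms $\phi:M\to M$ isotopic to the identity; equivalently functions on the quotient $\overline{\mathcal{F}}(M)$ of $\mathcal{F}(M)$ by $f\sim\phi^*f$. $Z(M)\,\widehat{\otimes}\,Z(N)$ is the set of functions $\overline{\mathcal{F}}(M)\times\overline{\mathcal{F}}(N)\to Q$, also regarded as functions on $\mathcal{F}(M)\times\mathcal{F}(N)$, and identified with $Z(M\sqcup N)$ via the bijection $\mathcal{F}(M\sqcup N)\cong\mathcal{F}(M)\times\mathcal{F}(N)$. For a bordism $W$ and $F\in\mathcal{F}(W)$, $T_W(F)\in Q$ is the characteristic function of the morphism $\mathbb{T}_W(F)$ (value $1\in S$ at $\mathbb{T}_W(F)$, $0$ elsewhere). For $f\in\mathcal{F}(\partial W)$ let $\mathcal{F}(W,f)=\{F\in\mathcal{F}(W)\mid F|_{\partial W}=f\}$. The state sum $Z_W\in Z(\partial W)$ is $Z_W(f)=\sum_{F\in\mathcal{F}(W,f)}T_W(F)\in Q$, using the summation law of $Q$. For $z\in Z(M)\,\widehat{\otimes}\,Z(N)$ and $z'\in Z(N)\,\widehat{\otimes}\,Z(P)$, the contraction inner product $\langle z,z'\rangle\in Z(M)\,\widehat{\otimes}\,Z(P)$ is $\langle z,z'\rangle(f,h)=\sum_{g\in\mathcal{F}(N)}z(f,g)\cdot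 z'(g,h)$ for $(f,h)\in\mathcal{F}(M)\times\mathcal{F}(P)$, with product in $Q^c$. *)

(* Defs.v *)
From HB Require Import structures.
From mathcomp Require Import all_boot all_order all_algebra.
From mathcomp Require Import all_classical all_reals.
From mathcomp Require Import topology normedtype.

Set Implicit Arguments.
Unset Strict Implicit.
Unset Printing Implicit Defensive.

Import Order.TTheory GRing.Theory Num.Theory numFieldNormedType.Exports.

Local Open Scope classical_set_scope.
Local Open Scope ring_scope.

(* A family (m_i)_(i in I) is a function I -> M on an arbitrary type I; the
   summation over the part of a partition indexed by j runs over the subtype
   {i | A j i}. Empty parts are allowed. *)
HB.mixin Record isCompleteMonoid (M : Type) of GRing.Nmodule M := {
  csum : forall I : Type, (I -> M) -> M;
  csum_void : forall m : void -> M, csum void m = 0;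
  csum_unit : forall m : unit -> M, csum unit m = m tt;
  csum_bool : forall m : bool -> M, csum bool m = m true + m false;
  csum_partition : forall (I J : Type) (A : J -> set I) (m : I -> M),
    trivIset [set: J] A -> \bigcup_j A j = [set: I] ->
    csum J (fun j => csum {i | A j i} (fun i => m (sval i))) = csum I m
}.

#[short(type="completeMonoidType")]
HB.structure Definition CompleteMonoid :=
  {M of GRing.Nmodule M & isCompleteMonoid M}.

Arguments csum {M I} m : rename.

HB.mixin Record CompleteMonoid_isCompleteSemiRing (S : Type)
    of GRing.PzSemiRing S & isCompleteMonoid S := {
  csumMr : forall (I : Type) (s : S) (m : I -> S),
    csum (fun i => s * m i) = s * csum m;
  csumMl : forall (I : Type) (s : S) (m : I -> S),
    csum (fun i => m i * s) = csum m * s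
}.

#[short(type="completeSemiRingType")]
HB.structure Definition CompleteSemiRing :=
  {S of GRing.PzSemiRing S & isCompleteMonoid S
      & CompleteMonoid_isCompleteSemiRing S}.

Section CompleteMonoidTheory.
Variable M : completeMonoidType.

Lemma eq_csum (I : Type) (m m' : I -> M) : m =1 m' -> csum m = csum m'.
Proof. by move=> /funext ->. Qed.

Lemma csum_contr (J : Type) (j0 : J) (m : J -> M) :
  (forall j, j = j0) -> csum m = m j0.
Proof.
move=> j0P; have mE : m = (fun=> m j0) by apply/funext => j; rewrite (j0P j).
have full (K : Type) (k0 : K) : (forall k, k = k0) ->
    csum (fun _ : K => csum (fun _ : {i : unit | setT i} => m j0)) = m j0.
  move=> k0P; rewrite -[RHS](csum_unit (fun=> m j0)).
  apply: (@csum_partition M unit K (fun=> setT) (fun=> m j0)).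
    by move=> i j _ _ _; rewrite (k0P i) (k0P j).
  by apply/seteqP; split=> // x _; exists k0.
have := full unit tt; rewrite csum_unit => inner.
rewrite {1}mE -[RHS](full J j0 j0P); apply: eq_csum => _.
by rewrite inner// => -[].
Qed.

Lemma csum_reindex (I J : Type) (h : J -> I) (m : I -> M) :
  bijective h -> csum (m \o h) = csum m.
Proof.
move=> [h' hK h'K].
rewrite -(@csum_partition M I J (fun j => [set h j]) m).
- apply: eq_csum => j /=.
  apply/esym/(@csum_contr _ (exist [set h j] (h j) erefl)).
  by case=> i /= ij; exact: eq_exist.
- by move=> i j _ _ [x [/= -> /(congr1 h')]]; rewrite !hK.
- by apply/seteqP; split=> // i _; exists (h' i); rewrite //= h'K.
Qed.

Lemma csum_sigT (J : Type) (I : J -> Type) (m : forall j, I j -> M) :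
  csum (fun j => csum (fun i => m j i)) =
  csum (fun s : {j & I j} => m (projT1 s) (projT2 s)).
Proof.
rewrite -(@csum_partition M _ J (fun j => [set s | projT1 s = j])); last 2 first.
- by move=> i j _ _ [s [/= -> ->]].
- by apply/seteqP; split=> // s _; exists (projT1 s).
apply: eq_csum => j.
pose h (i : I j) : {s : {j & I j} | projT1 s = j} := exist _ (existT _ j i) erefl.
rewrite -(@csum_reindex _ _ h)//.
exists (fun s => let: exist (existT _ i) e := s in ecast j (I j) e i) => //.
by case=> -[k i] /= e; destruct e.
Qed.

Lemma csum0 (I : Type) : csum (fun _ : I => 0 : M) = 0.
Proof.
have := @csum_sigT I (fun=> void) (fun _ _ => 0).
rewrite (eq_csum (m' := fun=> 0)) => [->|j]; last exact: csum_void.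
pose h (v : void) : {_ : I & void} := match v with end.
rewrite -(@csum_reindex _ _ h) ?csum_void//.
by exists (fun s : {_ : I & void} => projT2 s); case.
Qed.

Lemma exchange_csum (I J : Type) (m : I -> J -> M) :
  csum (fun i => csum (m i)) = csum (fun j => csum (m^~ j)).
Proof.
rewrite !csum_sigT.
pose h (s : {_ : J & I}) : {_ : I & J} := existT _ (projT2 s) (projT1 s).
rewrite -(@csum_reindex _ _ h)//.
by exists (fun s : {_ : I & J} => existT (fun=> I) (projT2 s) (projT1 s)); case.
Qed.

Lemma csumD (I : Type) (m m' : I -> M) :
  csum (fun i => m i + m' i) = csum m + csum m'.
Proof.
have := @exchange_csum bool I (fun b => if b then m else m').
rewrite csum_bool => ->; apply: eq_csum => i.
by rewrite csum_bool.
Qed.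

End CompleteMonoidTheory.

(* Strictness on morphisms relates arrows of hom sets that are only equal up to
   the strictness of the tensor on objects, so it is stated between arrows
   packed with their source and target. *)
Record strictMonoidalCategory := StrictMonoidalCategory {
  obj : Type;
  hom : obj -> obj -> Type;
  idm : forall x, hom x x;
  compm : forall x y z, hom y z -> hom x y -> hom x z;
  compmA : forall w x y z (h : hom y z) (g : hom x y) (f : hom w x),
    compm h (compm g f) = compm (compm h g) f;
  comp1m : forall x y (f : hom x y), compm (idm y) f = f;
  compm1 : forall x y (f : hom x y), compm f (idm x) = f;
  unit_obj : obj;
  tensor_obj : obj -> obj -> obj;
  tensor_hom : forall x y x' y',
    hom x y -> hom x' y' -> hom (tensor_obj x x') (tensor_obj y y');
  tensor_idm : forall x y,
    tensor_hom (idm x) (idm y) = idm (tensor_obj x y);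
  tensor_compm : forall x y z x' y' z' (g : hom y z) (f : hom x y)
      (g' : hom y' z') (f' : hom x' y'),
    tensor_hom (compm g f) (compm g' f') =
    compm (tensor_hom g g') (tensor_hom f f');
  tensor_objA : forall x y z,
    tensor_obj x (tensor_obj y z) = tensor_obj (tensor_obj x y) z;
  tensor_1obj : forall x, tensor_obj unit_obj x = x;
  tensor_obj1 : forall x, tensor_obj x unit_obj = x;
  tensor_homA : forall x y x' y' x'' y''
      (f : hom x y) (f' : hom x' y') (f'' : hom x'' y''),
    existT (fun st => hom st.1 st.2) (_, _)
      (tensor_hom f (tensor_hom f' f'')) =
    existT (fun st => hom st.1 st.2) (_, _)
      (tensor_hom (tensor_hom f f') f'');
  tensor_1hom : forall x y (f : hom x y),
    existT (fun st => hom st.1 st.2) (_, _) (tensor_hom (idm unit_obj) f) =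
    existT (fun st => hom st.1 st.2) (x, y) f;
  tensor_hom1 : forall x y (f : hom x y),
    existT (fun st => hom st.1 st.2) (_, _) (tensor_hom f (idm unit_obj)) =
    existT (fun st => hom st.1 st.2) (x, y) f
}.

Arguments idm {_} _.
Arguments unit_obj _ : clear implicits.

Record mor (C : strictMonoidalCategory) := Mor {
  src : obj C; tgt : obj C; arr :> hom src tgt }.
Arguments Mor {C src tgt}.

Definition tensorm (C : strictMonoidalCategory) (g f : mor C) : mor C :=
  Mor (tensor_hom (arr g) (arr f)).

(* [is_comp b a c] : the target of a is the source of b, and c = b o a. *)
Inductive is_comp (C : strictMonoidalCategory) : mor C -> mor C -> mor C -> Prop :=
  IsComp x y z (b : hom y z) (a : hom x y) :
    is_comp (Mor b) (Mor a) (Mor (compm b a)).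

Section CompTheory.
Variable C : strictMonoidalCategory.
Implicit Types a b c : mor C.

Lemma is_compP b a c : is_comp b a c <->
  exists e : tgt a = src b,
    c = Mor (compm b (ecast y (hom (src a) y) e (arr a))).
Proof.
split; first by case=> x y z g f; exists erefl.
by case: b a => y z b [x y' a] [/= e ->]; destruct e => /=; split.
Qed.

Lemma is_comp_inj b a c c' : is_comp b a c -> is_comp b a c' -> c = c'.
Proof.
move=> /is_compP[e ->] /is_compP[e' ->].
by rewrite (Prop_irrelevance e e').
Qed.

Lemma is_compAl d b a e c : is_comp d b e -> is_comp e a c ->
  exists2 f, is_comp b a f & is_comp d f c.
Proof.
move=> [x y z g f] /is_compP[]; case: a => w x' a /= e' ->; destruct e' => /=.
by rewrite -compmA; exists (Mor (compm f a)).
Qed.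

Lemma is_compAr d b a f c : is_comp b a f -> is_comp d f c ->
  exists2 e, is_comp d b e & is_comp e a c.
Proof.
move=> [x y z g f'] /is_compP[]; case: d => w x' d /= e' ->; destruct e' => /=.
by rewrite compmA; exists (Mor (compm d g)).
Qed.

End CompTheory.

Definition Q (S : Type) (C : strictMonoidalCategory) : Type := mor C -> S.

Section Q.
Variable (S : completeSemiRingType) (C : strictMonoidalCategory).
Implicit Types a b c : Q S C.

HB.instance Definition _ := gen_eqMixin (Q S C).
HB.instance Definition _ := gen_choiceMixin (Q S C).

Definition Qzero : Q S C := fun=> 0.
Definition Qadd a b : Q S C := fun g => a g + b g.
Definition Qsum (I : Type) (a : I -> Q S C) : Q S C := fun g => csum (fun i => a i g).
Definition Qone : Q S C := fun g => if `[< exists x, g = Mor (idm x) >] then 1 else 0.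
(* (a . b)(g) is the sum of b(beta) a(alpha) over beta o alpha = g: the factors
   are exchanged with respect to the order of the product. *)
Definition Qmul a b : Q S C := fun g =>
  csum (fun p : {p : mor C * mor C | is_comp p.1 p.2 g} =>
    b (sval p).1 * a (sval p).2).

Lemma QaddA : associative Qadd.
Proof. by move=> a b c; apply/funext => g; apply: addrA. Qed.
Lemma QaddC : commutative Qadd.
Proof. by move=> a b; apply/funext => g; apply: addrC. Qed.
Lemma Qadd0 : left_id Qzero Qadd.
Proof. by move=> a; apply/funext => g; apply: add0r. Qed.
HB.instance Definition _ := GRing.isNmodule.Build (Q S C) QaddA QaddC Qadd0.

Lemma Qsum_void (m : void -> Q S C) : Qsum m = 0.
Proof. by apply/funext => g; apply: csum_void. Qed.
Lemma Qsum_unit (m : unit -> Q S C) : Qsum m = m tt.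
Proof. by apply/funext => g; apply: csum_unit. Qed.
Lemma Qsum_bool (m : bool -> Q S C) : Qsum m = m true + m false.
Proof. by apply/funext => g; apply: csum_bool. Qed.
Lemma Qsum_partition (I J : Type) (A : J -> set I) (m : I -> Q S C) :
  trivIset [set: J] A -> \bigcup_j A j = [set: I] ->
  Qsum (fun j => Qsum (fun i : {i | A j i} => m (sval i))) = Qsum m.
Proof. by move=> tA cA; apply/funext => g; apply: csum_partition. Qed.
HB.instance Definition _ := isCompleteMonoid.Build (Q S C)
  Qsum_void Qsum_unit Qsum_bool Qsum_partition.

Lemma csum_sub1 (I : Type) (P : I -> Prop) (i0 : I) (m : I -> S) :
  P i0 -> (forall i, P i -> i <> i0 -> m i = 0) ->
  csum (fun i : {i | P i} => m (sval i)) = m i0.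
Proof.
move=> P0 m0.
rewrite -(@csum_partition S _ bool (fun (e : bool) i => e = `[< sval i = i0 >])); last 2 first.
- by move=> e e' _ _ [i [-> ->]].
- by apply/seteqP; split=> // i _; exists `[< sval i = i0 >].
rewrite csum_bool [X in _ + X](_ : _ = 0) ?addr0; last first.
  rewrite -[RHS](csum0 S {i : {i | P i} | false = `[< sval i = i0 >]}).
  apply: eq_csum => -[[i Pi] /= e]; apply: m0 => // ii0.
  by move/esym/asboolP: e.
have e0 : true = `[< sval (exist P i0 P0) = i0 >] by apply/esym/asboolP.
rewrite (@csum_contr _ _ (exist _ (exist P i0 P0) e0))//.
move=> [[i Pi] /= e]; apply: eq_exist; apply: eq_exist.
by apply/asboolP; rewrite -e.
Qed.

Lemma eq_pair_sigT (P : mor C * mor C -> Prop)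
    (R : mor C * mor C -> mor C * mor C -> Prop)
    (s t : {p : {p | P p} & {q | R (sval p) q}}) :
  sval (projT1 s) = sval (projT1 t) -> sval (projT2 s) = sval (projT2 t) -> s = t.
Proof.
case: s t => [[p Pp] [q Rq]] [[p' Pp'] [q' Rq']] /= pp' qq'.
by subst p' q'; rewrite (Prop_irrelevance Pp' Pp) (Prop_irrelevance Rq' Rq).
Qed.

Lemma QmulA : associative Qmul.
Proof.
move=> a b c; apply/funext => g; rewrite /Qmul.
under eq_csum do rewrite -csumMl.
under [RHS]eq_csum do rewrite -csumMr.
rewrite !csum_sigT.
pose T1 := {p : {p : mor C * mor C | is_comp p.1 p.2 g} &
  {q : mor C * mor C | is_comp q.1 q.2 (sval p).1}}.
pose T2 := {p : {p : mor C * mor C | is_comp p.1 p.2 g} &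
  {q : mor C * mor C | is_comp q.1 q.2 (sval p).2}}.
have hP (s : T1) : exists2 t : T2,
    (sval (projT1 t)).1 = (sval (projT2 s)).1 &
    sval (projT2 t) = ((sval (projT2 s)).2, (sval (projT1 s)).2).
  case: s => [[[be al] /= c1] [[de ep] /= c2]] /=.
  have [f c3 c4] := is_compAl c2 c1.
  by exists (existT _ (exist _ (de, f) c4) (exist _ (ep, al) c3)).
have kP (t : T2) : exists2 s : T1,
    (sval (projT1 s)).2 = (sval (projT2 t)).2 &
    sval (projT2 s) = ((sval (projT1 t)).1, (sval (projT2 t)).1).
  case: t => [[[be al] /= c1] [[de ep] /= c2]] /=.
  have [f c3 c4] := is_compAr c2 c1.
  by exists (existT _ (exist _ (f, ep) c4) (exist _ (be, de) c3)).
pose h (s : T1) : T2 := sval (cid2 (hP s)).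
pose k (t : T2) : T1 := sval (cid2 (kP t)).
have h1 s : (sval (projT1 (h s))).1 = (sval (projT2 s)).1.
  by rewrite /h; case: cid2.
have h2 s : sval (projT2 (h s)) = ((sval (projT2 s)).2, (sval (projT1 s)).2).
  by rewrite /h; case: cid2.
have k1 t : (sval (projT1 (k t))).2 = (sval (projT2 t)).2.
  by rewrite /k; case: cid2.
have k2 t : sval (projT2 (k t)) = ((sval (projT1 t)).1, (sval (projT2 t)).1).
  by rewrite /k; case: cid2.
have bij_h : bijective h.
  exists k => [s|t].
    apply: (@eq_pair_sigT (fun p => is_comp p.1 p.2 g)
      (fun p q => is_comp q.1 q.2 p.1)).
      rewrite [LHS]surjective_pairing [RHS]surjective_pairing k1 h2 /=; congr pair.
      apply: (@is_comp_inj _ (sval (projT2 s)).1 (sval (projT2 s)).2).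
        by have := svalP (projT2 (k (h s))); rewrite k2 /= h1 h2.
      exact: svalP (projT2 s).
    by rewrite k2 h1 h2/= -surjective_pairing.
  apply: (@eq_pair_sigT (fun p => is_comp p.1 p.2 g)
    (fun p q => is_comp q.1 q.2 p.2)).
    rewrite [LHS]surjective_pairing [RHS]surjective_pairing h1 k2 /=; congr pair.
    apply: (@is_comp_inj _ (sval (projT2 t)).1 (sval (projT2 t)).2).
      by have := svalP (projT2 (h (k t))); rewrite h2 /= k1 k2.
    exact: svalP (projT2 t).
  by rewrite h2 k1 k2/= -surjective_pairing.
rewrite -(csum_reindex _ bij_h); apply: eq_csum => s /=.
by rewrite h1 h2 /= mulrA.
Qed.

Lemma Qmul1 : right_id Qone Qmul.
Proof.
move=> a; apply/funext => g; rewrite /Qmul.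
pose m (p : mor C * mor C) := Qone p.1 * a p.2.
have g0 : is_comp (Mor (idm (tgt g))) g g.
  by apply/is_compP; exists erefl; rewrite comp1m; case: g.
rewrite (@csum_sub1 _ _ (Mor (idm (tgt g)), g) m)//.
  rewrite /m /Qone; case: asboolP => [_|[]]; first by rewrite mul1r.
  by exists (tgt g).
move=> [b f] /= bfg nbf; rewrite /m /Qone /=.
case: asboolP => [[x bx]|_]; last by rewrite mul0r.
case: nbf; subst b; case/is_compP: bfg => /= e.
by destruct e; rewrite comp1m => ->; case: f.
Qed.

Lemma Q1mul : left_id Qone Qmul.
Proof.
move=> a; apply/funext => g; rewrite /Qmul.
pose m (p : mor C * mor C) := a p.1 * Qone p.2.
have g0 : is_comp g (Mor (idm (src g))) g.
  by apply/is_compP; exists erefl; rewrite compm1; case: g.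
rewrite (@csum_sub1 _ _ (g, Mor (idm (src g))) m)//.
  rewrite /m /Qone; case: asboolP => [_|[]]; first by rewrite mulr1.
  by exists (src g).
move=> [b f] /= bfg nbf; rewrite /m /Qone /=.
case: asboolP => [[x fx]|_]; last by rewrite mulr0.
case: nbf; subst f; case/is_compP: bfg => /= e.
by case: b e => y z b /= e; destruct e => /=; rewrite compm1 => ->.
Qed.

Lemma QmulDl : left_distributive Qmul (@GRing.add (Q S C)).
Proof.
move=> a b c; apply/funext => g; symmetry.
transitivity (Qmul a c g + Qmul b c g); first by [].
by rewrite /Qmul -csumD; apply: eq_csum => p; rewrite -mulrDr.
Qed.

Lemma QmulDr : right_distributive Qmul (@GRing.add (Q S C)).
Proof.
move=> a b c; apply/funext => g; symmetry.
transitivity (Qmul a b g + Qmul a c g); first by [].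
by rewrite /Qmul -csumD; apply: eq_csum => p; rewrite -mulrDl.
Qed.

Lemma Qmul0 : right_zero 0 Qmul.
Proof.
move=> a; apply/funext => g; rewrite -[RHS](csum0 S {p | is_comp p.1 p.2 g}).
by apply: eq_csum => p; rewrite mul0r.
Qed.

Lemma Q0mul : left_zero 0 Qmul.
Proof.
move=> a; apply/funext => g; rewrite -[RHS](csum0 S {p | is_comp p.1 p.2 g}).
by apply: eq_csum => p; rewrite mulr0.
Qed.

HB.instance Definition _ := GRing.Nmodule_isPzSemiRing.Build (Q S C)
  QmulA Q1mul Qmul1 QmulDl QmulDr Q0mul Qmul0.

Lemma Q_csumMr (I : Type) (s : Q S C) (m : I -> Q S C) :
  csum (fun i => s * m i) = s * csum m.
Proof.
apply/funext => g; rewrite [LHS]exchange_csum.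
by apply: eq_csum => p; rewrite csumMl.
Qed.

Lemma Q_csumMl (I : Type) (s : Q S C) (m : I -> Q S C) :
  csum (fun i => m i * s) = csum m * s.
Proof.
apply/funext => g; rewrite [LHS]exchange_csum.
by apply: eq_csum => p; rewrite csumMr.
Qed.

HB.instance Definition _ := CompleteMonoid_isCompleteSemiRing.Build (Q S C)
  Q_csumMr Q_csumMl.

End Q.

Section SumTopology.
Variables X Y : topologicalType.

Definition sum_nbhs (s : X + Y) : set_system (X + Y) :=
  match s with inl x => inl @ nbhs x | inr y => inr @ nbhs y end.

HB.instance Definition _ := hasNbhs.Build (X + Y)%type sum_nbhs.

Lemma sum_nbhs_proper s : ProperFilter (sum_nbhs s).
Proof. by case: s => ?; exact: fmap_proper_filter. Qed.

Lemma sum_nbhs_singleton s A : sum_nbhs s A -> A s.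
Proof. by case: s => ? /= /nbhs_singleton. Qed.

Lemma sum_nbhs_nbhs s A : sum_nbhs s A -> sum_nbhs s (sum_nbhs^~ A).
Proof.
case: s => z /=; rewrite /fmap/= nbhsE => -[U [oU Uz] UA];
  exists U => // w Uw; exact/(filterS UA)/open_nbhs_nbhs.
Qed.

HB.instance Definition _ := Nbhs_isNbhsTopological.Build (X + Y)%type
  sum_nbhs_proper sum_nbhs_singleton sum_nbhs_nbhs.

Lemma inl_continuous : continuous (inl : X -> X + Y).
Proof. by move=> x A. Qed.

Lemma inr_continuous : continuous (inr : Y -> X + Y).
Proof. by move=> x A. Qed.

Lemma sum_openP (U : set (X + Y)) :
  open U <-> open (inl @^-1` U) /\ open (inr @^-1` U).
Proof.
split=> [oU|[oX oY]].
  by split; apply: open_comp => // x _; [exact: inl_continuous|exact: inr_continuous].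
rewrite openE => -[z|z] Uz; rewrite /interior /nbhs /= /fmap /=.
  exact: open_nbhs_nbhs.
exact: open_nbhs_nbhs.
Qed.

Lemma inl_open_map (A : set X) : open A -> open ((inl : X -> X + Y) @` A).
Proof.
move=> oA; apply/sum_openP; split.
  have -> : inl @^-1` ((inl : X -> X + Y) @` A) = A; last exact: oA.
  by apply/seteqP; split=> [x [y Ay [<-]]//|x Ax]; exists x.
have -> : inr @^-1` ((inl : X -> X + Y) @` A) = set0; last exact: open0.
by apply/seteqP; split=> // x [].
Qed.

Lemma inr_open_map (A : set Y) : open A -> open ((inr : Y -> X + Y) @` A).
Proof.
move=> oA; apply/sum_openP; split.
  have -> : inl @^-1` ((inr : Y -> X + Y) @` A) = set0; last exact: open0.
  by apply/seteqP; split=> // x [].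
have -> : inr @^-1` ((inr : Y -> X + Y) @` A) = A; last exact: oA.
by apply/seteqP; split=> [x [y Ay [<-]]//|x Ax]; exists x.
Qed.

Definition copair (Z : Type) (f : X -> Z) (g : Y -> Z) (s : X + Y) : Z :=
  match s with inl x => f x | inr y => g y end.

Lemma copair_continuous (Z : topologicalType) (f : X -> Z) (g : Y -> Z) :
  continuous f -> continuous g -> continuous (copair f g).
Proof. by move=> cf cg [] z A; [apply: cf|apply: cg]. Qed.

Lemma sum_setTE : [set: X + Y] = (inl @` setT) `|` (inr @` setT).
Proof.
by apply/seteqP; split=> // -[z|z] _; [left|right]; exists z.
Qed.

Lemma sum_compact : compact [set: X] -> compact [set: Y] -> compact [set: X + Y].
Proof.
move=> cX cY; rewrite sum_setTE; apply: compactU; apply: continuous_compact => //;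
  apply: continuous_subspaceT; [exact: inl_continuous|exact: inr_continuous].
Qed.

Lemma sum_hausdorff : hausdorff_space X -> hausdorff_space Y ->
  hausdorff_space (X + Y)%type.
Proof.
move=> hX hY [p|p] [q|q] clpq.
- congr inl; apply: hX => A B Ap Bq.
  have [] := clpq (inl @` A) (inl @` B).
  + by apply: filterS Ap => x; exists x.
  + by apply: filterS Bq => x; exists x.
  + by move=> _ [[x Ax <-] [y By [xy]]]; exists x; split=> //; rewrite -xy.
- have [] := clpq (range inl) (range inr).
  + by apply: filterS (@filterT _ _ (nbhs_filter p)) => x; exists x.
  + by apply: filterS (@filterT _ _ (nbhs_filter q)) => x; exists x.
  + by move=> _ [[x Ax <-] [y By]].
- have [] := clpq (range inr) (range inl).
  + by apply: filterS (@filterT _ _ (nbhs_filter p)) => x; exists x.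
  + by apply: filterS (@filterT _ _ (nbhs_filter q)) => x; exists x.
  + by move=> _ [[x Ax <-] [y By]].
- congr inr; apply: hY => A B Ap Bq.
  have [] := clpq (inr @` A) (inr @` B).
  + by apply: filterS Ap => x; exists x.
  + by apply: filterS Bq => x; exists x.
  + by move=> _ [[x Ax <-] [y By [xy]]]; exists x; split=> //; rewrite -xy.
Qed.

Lemma sum_second_countable : @second_countable X -> @second_countable Y ->
  @second_countable (X + Y)%type.
Proof.
move=> [BX cX [oX bX]] [BY cY [oY bY]].
exists ([set inl @` U | U in BX] `|` [set inr @` U | U in BY]).
  rewrite -bigcup2E; apply: bigcup_countable => // -[|[|k]] _ /=.
  - exact: (sub_countable (card_image_le _ _)).
  - exact: (sub_countable (card_image_le _ _)).
  - exact: countable0.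
split=> [_ [[U BU <-]|[U BU <-]]|].
- exact/inl_open_map/oX.
- exact/inr_open_map/oY.
move=> [z|z] A /= /=.
- move=> /bX[U [BU Uz] UA]; exists (inl @` U).
    by split; [left; exists U|exists z].
  by move=> _ [x Ux <-]; exact: UA.
- move=> /bY[U [BU Uz] UA]; exists (inr @` U).
    by split; [right; exists U|exists z].
  by move=> _ [x Ux <-]; exact: UA.
Qed.

End SumTopology.

Definition homeomorphism (X Y : topologicalType) (f : X -> Y) : Prop :=
  continuous f /\
  exists g : Y -> X, [/\ continuous g, cancel f g & cancel g f].

(* A homeomorphism onto its image. An inclusion of spaces is represented by an
   embedding throughout. *)
Definition embedding (X Y : topologicalType) (f : X -> Y) : Prop :=
  [/\ continuous f, injective f &
      forall U : set X, open U -> exists2 V, open V & U = f @^-1` V].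

(* [x] has an open neighbourhood homeomorphic to a relatively open subset
   of the model space [H] *)
Definition locally_modelled (E : topologicalType) (H : set E)
    (X : topologicalType) (x : X) : Prop :=
  exists (U : set X) (V : set E) (f : X -> E) (g : E -> X),
    [/\ open U, U x & open V] /\
    [/\ {homo f : y / U y >-> (V `&` H) y},
        {homo g : v / (V `&` H) v >-> U v},
        {in U, cancel f g} & {in V `&` H, cancel g f}] /\
    {within U, continuous f} /\ {within V `&` H, continuous g}.

Lemma locally_modelled_open (E : topologicalType) (H : set E)
    (X Y : topologicalType) (i : X -> Y) (r : Y -> X) (x : X) :
  continuous i -> continuous r -> cancel i r ->
  (forall A, open A -> open (i @` A)) ->
  locally_modelled H x <-> locally_modelled H (i x).
Proof.
move=> ci cr iK oi; split=> -[U [V [f [g [[oU Ux oV] [[fH gH fK gK] [cf cg]]]]]]].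
  exists (i @` U), V, (f \o r), (i \o g); split; first by split=> //; exact: oi.
  split; first split.
  - by move=> _ [y Uy <-]; rewrite /= iK; exact: fH.
  - by move=> v Vv; exists (g v) => //; exact: gH.
  - move=> y /set_mem[z Uz <-]; rewrite /comp iK fK ?inE//.
  - by move=> v Vv; rewrite /= iK gK.
  split.
  - apply/subspace_continuousP => _ [y Uy <-] A.
    have -> : from_subspace (i @` U) (f \o r) (i y) = f y. exact: (congr1 f (iK y)).
    move=> Ay; have /subspace_continuousP/(_ y Uy A Ay) := cf.
    move=> H1; have : nbhs (r (i y)) [set z | U z -> A (f z)].
      by rewrite iK; exact: H1.
    move/(cr (i y)) => H2.
    change (nbhs (i y) [set z | (i @` U) z -> A (f (r z))]).
    apply: (@filterS _ _ (nbhs_filter (i y)) [set z | U (r z) -> A (f (r z))] _ _ H2).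
    move=> z /= h [w Uw wz].
    by apply: h; rewrite -wz iK.
  - by move=> v; exact: (continuous_comp (cg v) (ci (g v))).
pose W := V `&` H.
have [V' [oV' V'E]] : exists V', open V' /\ V' `&` W = (g @^-1` range i) `&` W.
  have : open (g @^-1` (range i) : set (subspace W)).
    by apply: open_comp => [v _|]; [exact: cg|exact/oi/openT].
  rewrite open_subspaceP => -[V' oV' e]; exists V'; split=> //.
exists (i @^-1` U), (V `&` V'), (f \o i), (r \o g).
have WE v : ((V `&` V') `&` H) v <-> W v /\ range i (g v).
  have := congr1 (fun A => A v) V'E; rewrite /= /setI/= => e.
  split=> [[[Vv V'v] Hv]|[[Vv Hv] gv]].
    by have : (V' v /\ W v) by []; rewrite e => -[].
  by have : (range i (g v) /\ W v) by []; rewrite -e => -[].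
have ri y : range i y -> i (r y) = y by move=> [z _ <-]; rewrite iK.
split; first by split; [apply: open_comp => // y _; exact: ci|exact: Ux|exact: openI].
split; first split.
- move=> y Uy; apply/WE; split; first exact: fH.
  by rewrite /= fK ?inE//; exists y.
- by move=> v /WE[Wv /ri gv]; rewrite /= gv; exact: gH.
- by move=> y /set_mem Uy; rewrite /= fK ?iK//; exact: mem_set.
- by move=> v /set_mem /WE[Wv /ri gv]; rewrite /= gv gK//; exact: mem_set.
split.
- apply/subspace_continuousP => y Uy A Ay.
  have /subspace_continuousP/(_ (i y) Uy A Ay) := cf.
  by move=> H1; have /ci : nbhs (i y) [set z | U z -> A (f z)] by exact: H1.
- have sub : (V `&` V') `&` H `<=` W by move=> v /WE[].
  apply: (continuous_subspaceW sub).
  by move=> v; exact: (continuous_comp (cg v) (cr (g v))).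
Qed.

Lemma locally_modelled_inl (E : topologicalType) (H : set E)
  (X Y : topologicalType) (x : X) :
  locally_modelled H x <-> locally_modelled H (inl x : X + Y).
Proof.
apply: (@locally_modelled_open _ _ _ _ _ (copair id (fun=> x))) => //.
- exact: inl_continuous.
- by apply: copair_continuous => [?|]; [exact: cvg_id|exact: cst_continuous].
- exact: inl_open_map.
Qed.

Lemma locally_modelled_inr (E : topologicalType) (H : set E)
  (X Y : topologicalType) (y : Y) :
  locally_modelled H y <-> locally_modelled H (inr y : X + Y).
Proof.
apply: (@locally_modelled_open _ _ _ _ _ (copair (fun=> y) id)) => //.
- exact: inr_continuous.
- by apply: copair_continuous => [|?]; [exact: cst_continuous|exact: cvg_id].
- exact: inr_open_map.
Qed.

Lemma compact_embedding (X Y : topologicalType) (f : X -> Y) :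
  compact [set: X] -> hausdorff_space Y -> continuous f -> injective f ->
  embedding f.
Proof.
move=> cX hY cf fI; split=> // U oU; exists (~` (f @` ~` U)).
  rewrite openC; apply: compact_closed => //; apply: continuous_compact.
    exact: continuous_subspaceT.
  by apply: subclosed_compact cX _ => //; rewrite closedC.
apply/seteqP; split=> [x Ux [y nUy /fI yx]|x /= nfx]; first by apply: nUy; rewrite yx.
by apply: contrapT => nUx; apply: nfx; exists x.
Qed.

Lemma inl_embedding (X Y : topologicalType) : embedding (inl : X -> X + Y).
Proof.
split; [exact: inl_continuous|by move=> x y []|move=> U oU].
exists (inl @` U); first exact: inl_open_map.
by apply/seteqP; split=> [x Ux|x [y Uy [<-]]//]; exists x.
Qed.

Lemma inr_embedding (X Y : topologicalType) : embedding (inr : Y -> X + Y).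
Proof.
split; [exact: inr_continuous|by move=> x y []|move=> U oU].
exists (inr @` U); first exact: inr_open_map.
by apply/seteqP; split=> [x Ux|x [y Uy [<-]]//]; exists x.
Qed.

Lemma embedding_comp (X Y Z : topologicalType) (g : Y -> Z) (f : X -> Y) :
  embedding g -> embedding f -> embedding (g \o f).
Proof.
move=> [cg gI og] [cf fI of_]; split.
- by move=> x; apply: continuous_comp; [exact: cf|exact: cg].
- exact: inj_comp.
- by move=> U /of_[V /og[V' oV' ->] ->]; exists V'.
Qed.

Record emb (X Y : topologicalType) := Emb {
  emb_map :> X -> Y; embP : embedding emb_map }.

Record homeo (X Y : topologicalType) := Homeo {
  homeo_map :> X -> Y; homeoP : homeomorphism homeo_map }.

Section Bordisms.
Variables (R : realType) (n : nat).

(* Dimension n, without boundary; the empty space is allowed. *)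
Record closedManifold := ClosedManifold {
  mfd :> topologicalType;
  mfd_hausdorff : hausdorff_space mfd;
  mfd_second_countable : @second_countable mfd;
  mfd_compact : compact [set: mfd];
  mfd_locally_euclidean : forall x : mfd, locally_modelled [set: 'rV[R]_n] x }.

Lemma locally_modelled_sum (E : topologicalType) (H : set E) (X Y : topologicalType) :
  (forall x : X, locally_modelled H x) -> (forall y : Y, locally_modelled H y) ->
  forall s : X + Y, locally_modelled H s.
Proof.
move=> HX HY [x|y].
  exact: (iffLR (locally_modelled_inl H Y x) (HX x)).
exact: (iffLR (locally_modelled_inr H X y) (HY y)).
Qed.

Definition mfd_disj (M N : closedManifold) : closedManifold :=
  ClosedManifold
    (sum_hausdorff (@mfd_hausdorff M) (@mfd_hausdorff N))
    (sum_second_countable (@mfd_second_countable M) (@mfd_second_countable N))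
    (sum_compact (@mfd_compact M) (@mfd_compact N))
    (locally_modelled_sum (@mfd_locally_euclidean M) (@mfd_locally_euclidean N)).

Definition half_space : set 'rV[R]_n.+1 := [set v | 0 <= v ord0 ord0].

(* Boundary of an (n+1)-manifold: the points without a euclidean neighbourhood. *)
Definition boundary (X : topologicalType) : set X :=
  [set x | ~ locally_modelled [set: 'rV[R]_n.+1] x].
Arguments boundary : clear implicits.

(* The identification of M |_| N with the boundary is the embedding
   [bord_incl]; M and N themselves are abstract closed manifolds, so that the
   outgoing boundary of one bordism can be the incoming boundary of another. *)
Record bordism (M N : closedManifold) := Bordism {
  bord :> topologicalType;
  bord_hausdorff : hausdorff_space bord;
  bord_second_countable : @second_countable bord;
  bord_compact : compact [set: bord];
  bord_locally_half_euclidean : forall x : bord, locally_modelled half_space x;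
  bord_incl : mfd_disj M N -> bord;
  bord_incl_emb : embedding bord_incl;
  bord_incl_range : range bord_incl = boundary bord }.

Definition bord_in M N (W : bordism M N) (x : M) : W := bord_incl W (inl x).
Definition bord_out M N (W : bordism M N) (x : N) : W := bord_incl W (inr x).

Definition emb_inl (M N : closedManifold) : emb M (mfd_disj M N) :=
  Emb (@inl_embedding M N).
Definition emb_inr (M N : closedManifold) : emb N (mfd_disj M N) :=
  Emb (@inr_embedding M N).
Definition emb_bd M N (W : bordism M N) : emb (mfd_disj M N) W :=
  Emb (bord_incl_emb W).
Definition emb_in M N (W : bordism M N) : emb M W :=
  @Emb M W (bord_in W) (embedding_comp (bord_incl_emb W) (@inl_embedding M N)).
Definition emb_out M N (W : bordism M N) : emb N W :=
  @Emb N W (bord_out W) (embedding_comp (bord_incl_emb W) (@inr_embedding M N)).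

Section BordDisj.
Variables (M N M' N' : closedManifold) (W : bordism M N) (W' : bordism M' N').

Definition disj_incl (s : mfd_disj (mfd_disj M M') (mfd_disj N N')) : (W + W')%type :=
  match s with
  | inl (inl x) => inl (bord_in W x)
  | inl (inr x) => inr (bord_in W' x)
  | inr (inl y) => inl (bord_out W y)
  | inr (inr y) => inr (bord_out W' y)
  end.

Lemma disj_incl_emb : embedding disj_incl.
Proof.
have [cW iW _] := bord_incl_emb W; have [cW' iW' _] := bord_incl_emb W'.
apply: compact_embedding.
- exact: mfd_compact.
- by apply: sum_hausdorff; exact: bord_hausdorff.
- have -> : disj_incl = copair
      (copair (inl \o emb_in W) (inr \o emb_in W'))
      (copair (inl \o emb_out W) (inr \o emb_out W')).
    by apply/funext => -[[]|[]].
  apply: copair_continuous; apply: copair_continuous => x; apply: continuous_comp;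
   do ?[exact: inl_continuous|exact: inr_continuous].
  + by case: (embP (emb_in W)) => + _ _; apply.
  + by case: (embP (emb_in W')) => + _ _; apply.
  + by case: (embP (emb_out W)) => + _ _; apply.
  + by case: (embP (emb_out W')) => + _ _; apply.
- move=> [[x|x]|[x|x]] [[y|y]|[y|y]] //= [] => [/iW|/iW|/iW'|/iW'|/iW|/iW|/iW'|/iW'] //.
  all: by move=> [->].
Qed.

Lemma disj_incl_range : range disj_incl = boundary (W + W')%type.
Proof.
apply/seteqP; split.
- move=> _ [[[x|x]|[x|x]] _ <-] /=.
  + apply: contra_not (iffRL (locally_modelled_inl _ W' _)) _.
    by have : range (bord_incl W) (bord_in W x) by []; rewrite bord_incl_range.
  + apply: contra_not (iffRL (locally_modelled_inr _ W _)) _.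
    by have : range (bord_incl W') (bord_in W' x) by []; rewrite bord_incl_range.
  + apply: contra_not (iffRL (locally_modelled_inl _ W' _)) _.
    by have : range (bord_incl W) (bord_out W x) by []; rewrite bord_incl_range.
  + apply: contra_not (iffRL (locally_modelled_inr _ W _)) _.
    by have : range (bord_incl W') (bord_out W' x) by []; rewrite bord_incl_range.
- move=> [w|w] bw.
  + have : boundary W w by apply: contra_not (iffLR (locally_modelled_inl _ W' _)) bw.
    rewrite -bord_incl_range => -[[x|x] _ <-].
      by exists (inl (inl x)).
    by exists (inr (inl x)).
  + have : boundary W' w by apply: contra_not (iffLR (locally_modelled_inr _ W _)) bw.
    rewrite -bord_incl_range => -[[x|x] _ <-].
      by exists (inl (inr x)).
    by exists (inr (inr x)).
Qed.

Definition bord_disj : bordism (mfd_disj M M') (mfd_disj N N') :=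
  @Bordism (mfd_disj M M') (mfd_disj N N') (W + W')%type
    (sum_hausdorff (@bord_hausdorff _ _ W) (@bord_hausdorff _ _ W'))
    (sum_second_countable (@bord_second_countable _ _ W) (@bord_second_countable _ _ W'))
    (sum_compact (@bord_compact _ _ W) (@bord_compact _ _ W'))
    (locally_modelled_sum (@bord_locally_half_euclidean _ _ W) (@bord_locally_half_euclidean _ _ W'))
    disj_incl disj_incl_emb disj_incl_range.

End BordDisj.

(* As W0 is itself an (n+1)-manifold, its image is a codimension 0 submanifold. *)
Definition subbordism_map M0 N0 M N (W0 : bordism M0 N0) (W : bordism M N)
    (e : W0 -> W) : Prop :=
  [/\ embedding e,
      forall x : M0,
        let C := [set e (bord_in W0 y) | y in connected_component [set: M0] x] in
        C `&` boundary W = set0 \/ C `<=` range (bord_in W) &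
      forall x : N0,
        let C := [set e (bord_out W0 y) | y in connected_component [set: N0] x] in
        C `&` boundary W = set0 \/ C `<=` range (bord_out W)].

Record subbordism M0 N0 M N (W0 : bordism M0 N0) (W : bordism M N) := Subbordism {
  sub_map :> W0 -> W; subP : subbordism_map sub_map }.

Lemma inl_subbordism M N M' N' (W : bordism M N) (W' : bordism M' N') :
  @subbordism_map _ _ _ _ W (bord_disj W W') inl.
Proof.
split; first exact: inl_embedding.
- by move=> x C; right=> _ [y _ <-]; exists (inl y).
- by move=> x C; right=> _ [y _ <-]; exists (inl y).
Qed.

Lemma inr_subbordism M N M' N' (W : bordism M N) (W' : bordism M' N') :
  @subbordism_map _ _ _ _ W' (bord_disj W W') inr.
Proof.
split; first exact: inr_embedding.
- by move=> x C; right=> _ [y _ <-]; exists (inr y).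
- by move=> x C; right=> _ [y _ <-]; exists (inr y).
Qed.

Definition sub_inl M N M' N' (W : bordism M N) (W' : bordism M' N') :
  subbordism W (bord_disj W W') := Subbordism (inl_subbordism W W').
Definition sub_inr M N M' N' (W : bordism M N) (W' : bordism M' N') :
  subbordism W' (bord_disj W W') := Subbordism (inr_subbordism W W').

Record bordism_homeo M N M' N' (W : bordism M N) (W' : bordism M' N') := BordismHomeo {
  bh_map :> W -> W';
  bh_homeo : homeomorphism bh_map;
  bh_in : bh_map @` range (bord_in W) = range (bord_in W');
  bh_out : bh_map @` range (bord_out W) = range (bord_out W') }.

(* The equivalence relation that identifies the two copies of N. *)
Inductive glue_rel M N P (W' : bordism M N) (W'' : bordism N P) :
    W' + W'' -> W' + W'' -> Prop :=
  | GlueRefl s : glue_rel s s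
  | GlueLR x : glue_rel (inl (bord_out W' x)) (inr (bord_in W'' x))
  | GlueRL x : glue_rel (inr (bord_in W'' x)) (inl (bord_out W' x)).

(* W is the quotient space of the disjoint union of W' and W'' by [glue_rel],
   with the incoming boundary of W' and the outgoing boundary of W''. That such
   a quotient is a manifold is a theorem on collars; here it is part of W being
   a bordism. *)
Record gluing M N P (W' : bordism M N) (W'' : bordism N P) (W : bordism M P) := Gluing {
  glue_l : W' -> W;
  glue_r : W'' -> W;
  glue_surj : forall w, exists s, copair glue_l glue_r s = w;
  glue_fiber : forall s t, copair glue_l glue_r s = copair glue_l glue_r t <-> glue_rel s t;
  glue_open : forall U : set W, open U <-> open (copair glue_l glue_r @^-1` U);
  glue_in : forall x, glue_l (bord_in W' x) = bord_in W x;
  glue_out : forall x, glue_r (bord_out W'' x) = bord_out W x }.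

Section GluingTheory.
Variables (M N P : closedManifold).
Variables (W' : bordism M N) (W'' : bordism N P) (W : bordism M P).
Variable G : gluing W' W'' W.

Lemma glue_continuous : continuous (copair (glue_l G) (glue_r G)).
Proof. by apply/continuousP => U /(glue_open G). Qed.

Lemma glue_l_emb : embedding (glue_l G).
Proof.
apply: compact_embedding.
- exact: bord_compact.
- exact: bord_hausdorff.
- have -> : glue_l G = copair (glue_l G) (glue_r G) \o inl by [].
  by move=> x; apply: continuous_comp; [exact: inl_continuous|exact: glue_continuous].
- move=> x y xy; have /(glue_fiber G) e : copair (glue_l G) (glue_r G) (inl x) =
    copair (glue_l G) (glue_r G) (inl y) by [].
  by inversion e.
Qed.

Lemma glue_r_emb : embedding (glue_r G).
Proof.
apply: compact_embedding.
- exact: bord_compact.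
- exact: bord_hausdorff.
- have -> : glue_r G = copair (glue_l G) (glue_r G) \o inr by [].
  by move=> x; apply: continuous_comp; [exact: inr_continuous|exact: glue_continuous].
- move=> x y xy; have /(glue_fiber G) e : copair (glue_l G) (glue_r G) (inr x) =
    copair (glue_l G) (glue_r G) (inr y) by [].
  by inversion e.
Qed.

Lemma bord_in_out (A B : closedManifold) (V : bordism A B) x y : bord_in V x <> bord_out V y.
Proof. by case: (bord_incl_emb V) => _ inj _ /inj. Qed.

Lemma glue_lr (x : W') (y : W'') : glue_l G x = glue_r G y ->
  exists2 k, x = bord_out W' k & y = bord_in W'' k.
Proof.
move=> xy; have /(glue_fiber G) e : copair (glue_l G) (glue_r G) (inl x) =
  copair (glue_l G) (glue_r G) (inr y) by [].
by inversion e as [|k|]; exists k.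
Qed.

Lemma glue_out_in k : glue_l G (bord_out W' k) = glue_r G (bord_in W'' k).
Proof.
exact: (iffRL (glue_fiber G (inl (bord_out W' k)) (inr (bord_in W'' k))) (GlueLR _ _ k)).
Qed.

Lemma glue_interior k : ~ boundary W (glue_l G (bord_out W' k)).
Proof.
rewrite -bord_incl_range => -[[x|x] _].
  rewrite -[bord_incl W _]/(bord_in W x) -(glue_in G).
  by case: glue_l_emb => _ inj _ /inj /bord_in_out.
rewrite -[bord_incl W _]/(bord_out W x) -(glue_out G) glue_out_in.
by case: glue_r_emb => _ inj _ /inj /esym /bord_in_out.
Qed.

Lemma glue_l_subbordism : subbordism_map (glue_l G).
Proof.
split=> [|x C|x C]; first exact: glue_l_emb.
  by right=> _ [y _ <-]; rewrite glue_in; exists y.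
by left; apply/seteqP; split=> // w [[y _ <-]] /glue_interior.
Qed.

Lemma glue_r_subbordism : subbordism_map (glue_r G).
Proof.
split=> [|x C|x C]; first exact: glue_r_emb.
  by left; apply/seteqP; split=> // w [[y _ <-]]; rewrite -glue_out_in => /glue_interior.
by right=> _ [y _ <-]; rewrite glue_out; exists y.
Qed.

Definition sub_glue_l : subbordism W' W := Subbordism glue_l_subbordism.
Definition sub_glue_r : subbordism W'' W := Subbordism glue_r_subbordism.

End GluingTheory.

(* bfield and mfield are the fields on bordisms and on closed n-manifolds. The
   restrictions bres, mres and tres are those to subbordisms, to codimension 0
   submanifolds of closed n-manifolds and to closed codimension 1 submanifolds
   of bordisms; bpull and mpull are the actions of homeomorphisms. Any bordism
   or manifold without points stands for the empty one. *)
Record fieldSystem := FieldSystem {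
  bfield : forall M N, bordism M N -> Type;
  mfield : closedManifold -> Type;
  bfield_empty : forall M N (W : bordism M N), (W -> False) ->
    exists p : bfield W, forall f, f = p;
  mfield_empty : forall M : closedManifold, (M -> False) ->
    exists p : mfield M, forall f, f = p;
  bres : forall M0 N0 M N (W0 : bordism M0 N0) (W : bordism M N),
    subbordism W0 W -> bfield W -> bfield W0;
  mres : forall M0 M : closedManifold, emb M0 M -> mfield M -> mfield M0;
  tres : forall (L : closedManifold) M N (W : bordism M N), emb L W -> bfield W -> mfield L;
  bres_bres : forall M1 N1 M0 N0 M N
      (W1 : bordism M1 N1) (W0 : bordism M0 N0) (W : bordism M N)
      (i : subbordism W1 W0) (j : subbordism W0 W) (k : subbordism W1 W),
    k =1 j \o i -> forall f, bres i (bres j f) = bres k f;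
  mres_mres : forall (M1 M0 M : closedManifold)
      (i : emb M1 M0) (j : emb M0 M) (k : emb M1 M),
    k =1 j \o i -> forall f, mres i (mres j f) = mres k f;
  tres_bres : forall (L : closedManifold) M0 N0 M N (W0 : bordism M0 N0) (W : bordism M N)
      (i : emb L W0) (j : subbordism W0 W) (k : emb L W),
    k =1 j \o i -> forall f, tres i (bres j f) = tres k f;
  mres_tres : forall (L0 L : closedManifold) M N (W : bordism M N)
      (i : emb L0 L) (j : emb L W) (k : emb L0 W),
    k =1 j \o i -> forall f, mres i (tres j f) = tres k f;
  bpull : forall M N M' N' (W : bordism M N) (W' : bordism M' N'),
    bordism_homeo W W' -> bfield W' -> bfield W;
  mpull : forall M M' : closedManifold, homeo M M' -> mfield M' -> mfield M;
  bpull_bij : forall M N M' N' (W : bordism M N) (W' : bordism M' N')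
    (phi : bordism_homeo W W'), bijective (bpull phi);
  mpull_bij : forall (M M' : closedManifold) (phi : homeo M M'),
    bijective (mpull phi);
  bpull_id : forall M N (W : bordism M N) (phi : bordism_homeo W W),
    phi =1 id -> bpull phi =1 id;
  mpull_id : forall (M : closedManifold) (phi : homeo M M),
    phi =1 id -> mpull phi =1 id;
  bpull_comp : forall M N M' N' M'' N''
      (W : bordism M N) (W' : bordism M' N') (W'' : bordism M'' N'')
      (phi : bordism_homeo W W') (psi : bordism_homeo W' W'')
      (chi : bordism_homeo W W''),
    chi =1 psi \o phi -> bpull chi =1 bpull phi \o bpull psi;
  mpull_comp : forall (M M' M'' : closedManifold)
      (phi : homeo M M') (psi : homeo M' M'') (chi : homeo M M''),
    chi =1 psi \o phi -> mpull chi =1 mpull phi \o mpull psi;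
  bpull_bres : forall M0 N0 M N M0' N0' M' N'
      (W0 : bordism M0 N0) (W : bordism M N)
      (W0' : bordism M0' N0') (W' : bordism M' N')
      (i : subbordism W0 W) (i' : subbordism W0' W')
      (phi0 : bordism_homeo W0 W0') (phi : bordism_homeo W W'),
    phi \o i =1 i' \o phi0 ->
    forall f, bres i (bpull phi f) = bpull phi0 (bres i' f);
  mpull_mres : forall (M0 M M0' M' : closedManifold)
      (i : emb M0 M) (i' : emb M0' M') (phi0 : homeo M0 M0') (phi : homeo M M'),
    phi \o i =1 i' \o phi0 ->
    forall f, mres i (mpull phi f) = mpull phi0 (mres i' f);
  bpull_tres : forall (L L' : closedManifold) M N M' N'
      (W : bordism M N) (W' : bordism M' N')
      (i : emb L W) (i' : emb L' W') (phi0 : homeo L L') (phi : bordism_homeo W W'),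
    phi \o i =1 i' \o phi0 ->
    forall f, tres i (bpull phi f) = mpull phi0 (tres i' f);
  bfield_disj : forall M N M' N' (W : bordism M N) (W' : bordism M' N'),
    bijective (fun f : bfield (bord_disj W W') =>
      (bres (sub_inl W W') f, bres (sub_inr W W') f));
  mfield_disj : forall M N : closedManifold,
    bijective (fun f : mfield (mfd_disj M N) =>
      (mres (emb_inl M N) f, mres (emb_inr M N) f));
  bfield_glue : forall M N P (W' : bordism M N) (W'' : bordism N P)
      (W : bordism M P) (G : gluing W' W'' W),
    set_bij [set: bfield W]
      [set p : bfield W' * bfield W'' |
        tres (emb_out W') p.1 = tres (emb_in W'') p.2]
      (fun f => (bres (sub_glue_l G) f, bres (sub_glue_r G) f)) }.

Record actionExponentials (C : strictMonoidalCategory) (F : fieldSystem) :=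
    ActionExponentials {
  texp : forall M N (W : bordism M N), bfield F W -> mor C;
  texp_empty : forall M N (W : bordism M N), (W -> False) ->
    forall p : bfield F W, texp p = Mor (idm (unit_obj C));
  texp_disj : forall M N M' N' (W : bordism M N) (W' : bordism M' N')
      (f : bfield F (bord_disj W W')),
    texp f = tensorm (texp (bres (sub_inl W W') f)) (texp (bres (sub_inr W W') f));
  texp_glue : forall M N P (W' : bordism M N) (W'' : bordism N P)
      (W : bordism M P) (G : gluing W' W'' W) (f : bfield F W),
    is_comp (texp (bres (sub_glue_r G) f)) (texp (bres (sub_glue_l G) f)) (texp f);
  texp_homeo : forall M N M' N' (W : bordism M N) (W' : bordism M' N')
      (phi : bordism_homeo W W') (f : bfield F W'),
    texp (bpull phi f) = texp f }.

Definition isotopic_to_id (M : closedManifold) (phi : M -> M) : Prop :=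
  exists H : R * M -> M,
    [/\ {within `[0, 1]%classic `*` [set: M], continuous H},
        forall t : R, 0 <= t <= 1 -> homeomorphism (fun x => H (t, x)),
        forall x, H (0, x) = x & forall x, H (1, x) = phi x].

Section StateSum.
Variables (S : completeSemiRingType) (C : strictMonoidalCategory).
Variables (F : fieldSystem) (T : actionExponentials C F).

Definition state_module (M : closedManifold) (z : mfield F M -> Q S C) : Prop :=
  forall phi : homeo M M, isotopic_to_id phi ->
  forall f, z (mpull phi f) = z f.

(* Functions on the product of the quotients of F(M) and F(N), regarded as
   functions on F(M) x F(N). *)
Definition state_tensor (M N : closedManifold)
    (z : mfield F M -> mfield F N -> Q S C) : Prop :=
  (forall phi : homeo M M, isotopic_to_id phi ->
    forall f g, z (mpull phi f) g = z f g) /\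
  (forall psi : homeo N N, isotopic_to_id psi ->
    forall f g, z f (mpull psi g) = z f g).

Lemma mfield_disj_surj (M N : closedManifold) (p : mfield F M * mfield F N) :
  exists f : mfield F (mfd_disj M N),
    (mres (emb_inl M N) f, mres (emb_inr M N) f) = p.
Proof. by case: (mfield_disj F M N) => g _ gK; exists (g p). Qed.

Definition mfield_join (M N : closedManifold) (p : mfield F M * mfield F N) :
    mfield F (mfd_disj M N) := sval (cid (mfield_disj_surj p)).

(* The identification of Z(M |_| N) with the completed tensor product. *)
Definition state_split (M N : closedManifold)
    (z : mfield F (mfd_disj M N) -> Q S C) : mfield F M -> mfield F N -> Q S C :=
  fun f g => z (mfield_join (f, g)).

Definition char_mor (g : mor C) : Q S C := fun h => if `[< h = g >] then 1 else 0.

Definition state_sum M N (W : bordism M N) : mfield F (mfd_disj M N) -> Q S C :=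
  fun f => csum (fun e : {e : bfield F W | tres (emb_bd W) e = f} =>
    char_mor (texp T (sval e))).

Definition contraction_product (M N P : closedManifold)
    (z : mfield F M -> mfield F N -> Q S C) (z' : mfield F N -> mfield F P -> Q S C) :
    mfield F M -> mfield F P -> Q S C :=
  fun f h => csum (fun g => z f g * z' g h).

End StateSum.
End Bordisms.

(* Main.v *)
Require Import Defs.
From HB Require Import structures.
From mathcomp Require Import all_boot all_order all_algebra.
From mathcomp Require Import all_classical all_reals.
From mathcomp Require Import topology normedtype.

(** A field on W is the same thing as a pair of fields on W' and W'' that
    agree on N.  Hence the fields on W with boundary values (f, h) are the
    triples (g, e', e'') where g is a field on N and e', e'' have boundary
    values (f, g) and (g, h): this is [reindex_glue].  The action of such a
    field is the composite of the actions of e' and e'', and characteristic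
    functions multiply as the morphisms compose ([char_mor_comp]), so Z_W (f, h)
    is the sum of T(e') T(e'') over these triples.  Summing over e' and e''
    with g fixed, and pulling the two sums out of the product by infinite
    distributivity, gives Z_W' (f, g) Z_W'' (g, h); the remaining sum over g is
    the contraction product.

    For the invariance of Z_W under isotopies, isotopies of two manifolds
    combine into one of their disjoint union ([isotopic_to_id_sum]), so that a
    state on M |_| N is invariant in each variable separately
    ([state_split_tensor]); the contraction product inherits the invariance
    in the first and in the last variable. *)

Set Implicit Arguments.
Unset Strict Implicit.
Unset Printing Implicit Defensive.

Import Order.TTheory GRing.Theory Num.Theory numFieldNormedType.Exports.

Local Open Scope classical_set_scope.
Local Open Scope ring_scope.

(** * Sums in complete semirings *)

Lemma csum_inj_surj (M : completeMonoidType) (I J : Type) (h : J -> I)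
    (m : I -> M) :
  injective h -> (forall i, exists j, h j = i) -> csum m = csum (m \o h).
Proof.
move=> hI hS; apply/esym/csum_reindex.
exists (fun i => sval (cid (hS i))) => [j|i]; last by case: cid.
by apply: hI; case: cid.
Qed.

Lemma csum_mul (S : completeSemiRingType) (I J : Type) (a : I -> S) (b : J -> S) :
  csum a * csum b = csum (fun i => csum (fun j => a i * b j)).
Proof. by rewrite -csumMl; apply: eq_csum => i; rewrite csumMr. Qed.

(** The product of Q sums over the factorisations of a morphism, and only the
    factorisation b o a meets both supports.  The factor a, which acts first,
    stands on the left. *)
Lemma char_mor_comp (S : completeSemiRingType) (C : strictMonoidalCategory)
    (b a c : mor C) :
  is_comp b a c -> char_mor S a * char_mor S b = char_mor S c.
Proof.
move=> bac; apply/funext => g.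
pose m (p : mor C * mor C) : S := char_mor S b p.1 * char_mor S a p.2.
rewrite -[LHS]/(csum (fun p : {p | is_comp p.1 p.2 g} => m (sval p))).
have m0 p : p <> (b, a) -> m p = 0.
  case: p => b' a' ne; rewrite /m /char_mor /=.
  case: asboolP => [eb|_]; last by rewrite mul0r.
  case: asboolP => [ea|_]; last by rewrite mulr0.
  by case: ne; rewrite eb ea.
rewrite [RHS]/char_mor; case: asboolP => [->|ng].
  rewrite (csum_sub1 (i0 := (b, a)))//= /m /char_mor /=; last by move=> p _ /m0.
  by rewrite !asboolT ?mulr1.
rewrite -[RHS](csum0 S {p : mor C * mor C | is_comp p.1 p.2 g}).
apply: eq_csum => -[p /= pg]; apply: m0 => pE; apply: ng.
by rewrite pE in pg; exact: is_comp_inj pg bac.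
Qed.

(** * Isotopies of disjoint unions *)

Definition sum_map (X Y X' Y' : Type) (f : X -> X') (g : Y -> Y') (s : X + Y) :
    X' + Y' :=
  match s with inl x => inl (f x) | inr y => inr (g y) end.

Lemma sum_map_continuous (X Y X' Y' : topologicalType)
    (f : X -> X') (g : Y -> Y') :
  continuous f -> continuous g -> continuous (sum_map f g).
Proof.
move=> cf cg.
have -> : sum_map f g = copair (inl \o f) (inr \o g) by apply/funext => -[].
apply: copair_continuous => x; apply: continuous_comp;
  [exact: cf|exact: inl_continuous|exact: cg|exact: inr_continuous].
Qed.

Lemma homeomorphism_sum (X Y X' Y' : topologicalType)
    (f : X -> X') (g : Y -> Y') :
  homeomorphism f -> homeomorphism g -> homeomorphism (sum_map f g).
Proof.
move=> [cf [f' [cf' fK f'K]]] [cg [g' [cg' gK g'K]]].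
split; first exact: sum_map_continuous.
exists (sum_map f' g'); split; first exact: sum_map_continuous.
- by case=> x /=; rewrite ?fK ?gK.
- by case=> x /=; rewrite ?f'K ?g'K.
Qed.

Lemma homeomorphism_id (X : topologicalType) : homeomorphism (@idfun X).
Proof.
split; first by move=> x; exact: cvg_id.
by exists idfun; split=> // x; exact: cvg_id.
Qed.

Definition homeo_sum (R : realType) (n : nat) (M N : closedManifold R n)
    (phi : homeo M M) (psi : homeo N N) :
    homeo (mfd_disj M N) (mfd_disj M N) :=
  @Homeo (mfd_disj M N) (mfd_disj M N) (sum_map phi psi)
    (homeomorphism_sum (homeoP phi) (homeoP psi)).

Definition homeo_id (X : topologicalType) : homeo X X :=
  Homeo (@homeomorphism_id X).

(** The product with X of each of the two inclusions into Y + Z is an open map,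
    so continuity on X * (Y + Z) can be tested on the two halves. *)
Lemma within_prod_sum_continuous (X Y Z V : topologicalType) (A : set X)
    (f : X * (Y + Z) -> V) :
  {within A `*` setT, continuous (fun p : X * Y => f (p.1, inl p.2))} ->
  {within A `*` setT, continuous (fun p : X * Z => f (p.1, inr p.2))} ->
  {within A `*` setT, continuous f}.
Proof.
move=> /subspace_continuousP cl /subspace_continuousP cr.
apply/subspace_continuousP => -[x [y|z]] [/= Ax _] B Bf.
- have [[U1 U2] /= [U1x U2y] sub] := cl (x, y) (conj Ax I) B Bf.
  exists (U1, inl @` U2).
    by split=> //=; apply: filterS U2y => w; exists w.
  by move=> [x' _] /= [U1x' [w U2w <-]] Ax'; exact: (sub (x', w)).
- have [[U1 U2] /= [U1x U2z] sub] := cr (x, z) (conj Ax I) B Bf.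
  exists (U1, inr @` U2).
    by split=> //=; apply: filterS U2z => w; exists w.
  by move=> [x' _] /= [U1x' [w U2w <-]] Ax'; exact: (sub (x', w)).
Qed.

Lemma isotopic_to_id_sum (R : realType) (n : nat) (M N : closedManifold R n)
    (phi : M -> M) (psi : N -> N) :
  isotopic_to_id phi -> isotopic_to_id psi ->
  @isotopic_to_id R n (mfd_disj M N) (sum_map phi psi).
Proof.
move=> [H [cH hH H0 H1]] [K [cK hK K0 K1]].
exists (fun p => sum_map (fun x => H (p.1, x)) (fun y => K (p.1, y)) p.2).
split=> [|t t01|[] x /=|[] x /=]; rewrite ?H0 ?K0 ?H1 ?K1//.
  apply: within_prod_sum_continuous => p /=.
  - have -> : (fun q : R * M => inl (H (q.1, q.2)) : M + N) = inl \o H.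
      by apply/funext => -[].
    exact: (continuous_comp (cH p) (@inl_continuous M N (H p))).
  - have -> : (fun q : R * N => inr (K (q.1, q.2)) : M + N) = inr \o K.
      by apply/funext => -[].
    exact: (continuous_comp (cK p) (@inr_continuous M N (K p))).
exact: homeomorphism_sum (hH _ t01) (hK _ t01).
Qed.

Lemma isotopic_to_id_id (R : realType) (n : nat) (M : closedManifold R n) :
  isotopic_to_id (@idfun M).
Proof.
exists snd; split=> // [|t _]; last exact: homeomorphism_id.
by apply: continuous_subspaceT => p; exact: cvg_snd.
Qed.

(** * Fields on disjoint unions and on boundaries *)

Section Fields.
Variables (R : realType) (n : nat) (F : fieldSystem R n).

Lemma mfield_disj_ext (M N : closedManifold R n) (e e' : mfield F (mfd_disj M N)) :
  mres (emb_inl M N) e = mres (emb_inl M N) e' ->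
  mres (emb_inr M N) e = mres (emb_inr M N) e' -> e = e'.
Proof.
by move=> el er; apply: (bij_inj (mfield_disj F M N)); rewrite el er.
Qed.

Lemma mres_mfield_join (M N : closedManifold R n) (f : mfield F M) (g : mfield F N) :
  mres (emb_inl M N) (mfield_join (f, g)) = f /\
  mres (emb_inr M N) (mfield_join (f, g)) = g.
Proof. by rewrite /mfield_join; case: cid => e /= [-> ->]. Qed.

Lemma mpull_mfield_join (M N : closedManifold R n)
    (phi : homeo M M) (psi : homeo N N) (f : mfield F M) (g : mfield F N) :
  mpull (homeo_sum phi psi) (mfield_join (f, g)) =
  mfield_join (mpull phi f, mpull psi g).
Proof.
have [fl gr] := mres_mfield_join f g.
have [fl' gr'] := mres_mfield_join (mpull phi f) (mpull psi g).
apply: mfield_disj_ext.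
- by rewrite (mpull_mres (i' := emb_inl M N) (phi0 := phi))// fl fl'.
- by rewrite (mpull_mres (i' := emb_inr M N) (phi0 := psi))// gr gr'.
Qed.

Lemma tres_bd_join (M N : closedManifold R n) (W : bordism M N)
    (e : bfield F W) (f : mfield F M) (g : mfield F N) :
  tres (emb_bd W) e = mfield_join (f, g) <->
  tres (emb_in W) e = f /\ tres (emb_out W) e = g.
Proof.
have inE : mres (emb_inl M N) (tres (emb_bd W) e) = tres (emb_in W) e.
  exact: mres_tres.
have outE : mres (emb_inr M N) (tres (emb_bd W) e) = tres (emb_out W) e.
  exact: mres_tres.
have [fl gr] := mres_mfield_join f g.
split=> [eE|[ef eg]]; first by rewrite -inE -outE eE.
by apply: mfield_disj_ext; rewrite ?inE ?outE ?fl ?gr.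
Qed.

Definition bounded_field (M N : closedManifold R n) (W : bordism M N)
    (f : mfield F M) (g : mfield F N) :=
  {e : bfield F W | tres (emb_bd W) e = mfield_join (f, g)}.

Section Glue.
Variables (M N P : closedManifold R n).
Variables (W' : bordism M N) (W'' : bordism N P) (W : bordism M P).
Variable G : gluing W' W'' W.

Lemma glue_tres_in (e : bfield F W) :
  tres (emb_in W') (bres (sub_glue_l G) e) = tres (emb_in W) e.
Proof. by apply: tres_bres => x /=; rewrite (glue_in G). Qed.

Lemma glue_tres_out (e : bfield F W) :
  tres (emb_out W'') (bres (sub_glue_r G) e) = tres (emb_out W) e.
Proof. by apply: tres_bres => x /=; rewrite (glue_out G). Qed.

Lemma glue_tres_mid (e : bfield F W) :
  tres (emb_out W') (bres (sub_glue_l G) e) =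
  tres (emb_in W'') (bres (sub_glue_r G) e).
Proof. by have [+ _ _] := bfield_glue F G => /(_ e I). Qed.

(** The nesting is the one that two applications of [csum_sigT] produce from a
    sum over g, then e', then e''. *)
Definition matching_fields (f : mfield F M) (h : mfield F P) :=
  {s : {g : mfield F N & bounded_field W' f g} & bounded_field W'' (projT1 s) h}.

(** The field on N need not be compared: it is the restriction of e'. *)
Lemma matching_fields_ext (f : mfield F M) (h : mfield F P)
    (s t : matching_fields f h) :
  sval (projT2 (projT1 s)) = sval (projT2 (projT1 t)) ->
  sval (projT2 s) = sval (projT2 t) -> s = t.
Proof.
case: s t => -[g [e' Ee']] /= [e'' Ee''] [[k [d' Ed']] /= [d'' Ed'']] /= ed' ed''.
subst d' d''.
have [_ eg] := iffLR (tres_bd_join _ _ _) Ee'.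
have [_ ek] := iffLR (tres_bd_join _ _ _) Ed'.
have gk : g = k by rewrite -eg -ek.
clear eg ek; subst k; rewrite (Prop_irrelevance Ed' Ee').
by rewrite (Prop_irrelevance Ed'' Ee'').
Qed.

Lemma bounded_field_split (f : mfield F M) (h : mfield F P)
    (e : bounded_field W f h) :
  exists s : matching_fields f h,
    sval (projT2 (projT1 s)) = bres (sub_glue_l G) (sval e) /\
    sval (projT2 s) = bres (sub_glue_r G) (sval e).
Proof.
case: e => e /= /tres_bd_join[ef eh].
pose e' := bres (sub_glue_l G) e; pose e'' := bres (sub_glue_r G) e.
have E' : tres (emb_bd W') e' = mfield_join (f, tres (emb_out W') e').
  by apply/tres_bd_join; rewrite glue_tres_in.
have E'' : tres (emb_bd W'') e'' = mfield_join (tres (emb_out W') e', h).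
  by apply/tres_bd_join; rewrite glue_tres_out glue_tres_mid.
by exists (existT (fun s : {g & bounded_field W' f g} => bounded_field W'' (projT1 s) h)
  (existT (bounded_field W' f) _ (exist _ e' E')) (exist _ e'' E'')).
Qed.

(** Cutting along N is a bijection from fields on W to matching fields: e' and
    e'' restrict to the same g on N, so they glue, and in exactly one way. *)
Lemma reindex_glue (A : completeMonoidType) (f : mfield F M) (h : mfield F P)
    (m : bfield F W' -> bfield F W'' -> A) :
  csum (fun s : matching_fields f h =>
    m (sval (projT2 (projT1 s))) (sval (projT2 s))) =
  csum (fun e : bounded_field W f h =>
    m (bres (sub_glue_l G) (sval e)) (bres (sub_glue_r G) (sval e))).
Proof.
have [_ glueI glueS] := bfield_glue F G.
pose cut e := sval (cid (@bounded_field_split f h e)).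
have cutP e : sval (projT2 (projT1 (cut e))) = bres (sub_glue_l G) (sval e) /\
    sval (projT2 (cut e)) = bres (sub_glue_r G) (sval e).
  by rewrite /cut; case: cid.
rewrite (csum_inj_surj (h := cut)).
- by apply: eq_csum => e /=; have [-> ->] := cutP e.
- move=> d e de; have [dl dr] := cutP d; have [el er] := cutP e.
  have : sval d = sval e.
    by apply: glueI; rewrite ?inE// -dl -dr -el -er de.
  by case: d e {de dl dr el er} => d Ed [e Ee] /= de; exact: eq_exist.
- move=> s; pose e' := projT2 (projT1 s); pose e'' := projT2 s.
  have [e'f e'g] := iffLR (tres_bd_join _ _ _) (svalP e').
  have [e''g e''h] := iffLR (tres_bd_join _ _ _) (svalP e'').
  have [|e _ [el er]] := glueS (sval e', sval e''); first by rewrite /= e'g e''g.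
  have E : tres (emb_bd W) e = mfield_join (f, h).
    apply/tres_bd_join.
    by rewrite -glue_tres_in -glue_tres_out el er.
  exists (exist _ e E); have [/= cl cr] := cutP (exist _ e E).
  by apply: matching_fields_ext; rewrite ?cl ?cr ?el ?er.
Qed.

End Glue.

End Fields.

(** * State sums and contraction products *)

Section States.
Variables (R : realType) (n : nat) (S : completeSemiRingType).
Variables (C : strictMonoidalCategory) (F : fieldSystem R n).

Lemma state_split_glue (T : actionExponentials C F) (M N P : closedManifold R n)
    (W' : bordism M N) (W'' : bordism N P) (W : bordism M P)
    (G : gluing W' W'' W) :
  state_split (state_sum S T W) =
  contraction_product (state_split (state_sum S T W'))
                      (state_split (state_sum S T W'')).
Proof.
apply/funext => f; apply/funext => h; apply/esym.
pose m (e' : bfield F W') (e'' : bfield F W'') : Q S C :=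
  char_mor S (texp T e') * char_mor S (texp T e'').
transitivity (csum (fun g => csum (fun e' : bounded_field W' f g =>
    csum (fun e'' : bounded_field W'' g h => m (sval e') (sval e''))))).
  by apply: eq_csum => g; exact: csum_mul.
rewrite csum_sigT csum_sigT (reindex_glue G f h m).
by apply: eq_csum => e; exact: char_mor_comp (texp_glue T G (sval e)).
Qed.

Lemma state_split_tensor (M N : closedManifold R n)
    (z : mfield F (mfd_disj M N) -> Q S C) :
  state_module z -> state_tensor (state_split z).
Proof.
move=> zP.
have id_pull (L : closedManifold R n) (k : mfield F L) : mpull (homeo_id L) k = k.
  exact: mpull_id.
split=> [phi phi1 f g|psi psi1 f g]; rewrite /state_split.
- rewrite -[in LHS](id_pull _ g) -mpull_mfield_join zP//.
  exact: isotopic_to_id_sum phi1 (isotopic_to_id_id N).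
- rewrite -[in LHS](id_pull _ f) -mpull_mfield_join zP//.
  exact: isotopic_to_id_sum (isotopic_to_id_id M) psi1.
Qed.

Lemma contraction_product_tensor (M N P : closedManifold R n)
    (z : mfield F M -> mfield F N -> Q S C)
    (z' : mfield F N -> mfield F P -> Q S C) :
  state_tensor z -> state_tensor z' -> state_tensor (contraction_product z z').
Proof.
move=> [zl _] [_ zr']; split=> [phi phi1 f h|psi psi1 f h]; apply: eq_csum => g.
- by rewrite zl.
- by rewrite zr'.
Qed.

End States.

Theorem theorem6p10 (R : realType) (n : nat) (S : completeSemiRingType)
    (C : strictMonoidalCategory) (F : fieldSystem R n)
    (T : actionExponentials C F) (M N P : closedManifold R n)
    (W' : bordism M N) (W'' : bordism N P) (W : bordism M P)
    (G : gluing W' W'' W) :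
  state_split (state_sum S T W) =
    contraction_product (state_split (state_sum S T W'))
                        (state_split (state_sum S T W''))
  /\ (state_module (state_sum S T W') -> state_module (state_sum S T W'') ->
      state_tensor (state_split (state_sum S T W))).
Proof.
have ZW := state_split_glue S T G.
split=> // zW' zW''; rewrite ZW.
by apply: contraction_product_tensor; exact: state_split_tensor.
Qed.
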